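(* Every strictly non-expanding $*$-algebra is $O^*$-representable.
   Context: $F_*$ is the free associative algebra over $\mathbb{C}$ on generators $x_1,\dots,x_m,x_1^*,\dots,x_m^*$, with the (conjugate-linear, anti-multiplicative) involution determined by $(x_j)^*=x_j^*$. $W$ is the set of all words (including the empty one) in the $2m$ generators. A linear order on the generators is fixed, and words are ordered by length first and then lexicographically. For $f\in F_*$ and $z\in W$, $z\prec f$ means that $z$ has nonzero coefficient in $f$. For $f\neq 0$, $\hat f$ is the greatest word $z\prec f$. Elements $f,g$ form a composition $w=xyz$ if there are words $x,z$ and a nonempty word $y$ with $\hat f=xy$, $\hat g=yz$; its result is $(f,g)_w=\beta fz-\alpha xg$, where $\alpha,\beta$ are the leading coefficients of $f,g$. A set $S\subseteq F_*$ (of nonzero elements) is closed under compositions if for all $f,g\in S$: (i) if $f\ne g$ then $\hat f$ is not a subword of $\hat g$; (ii) if $f,g$ form a composition $w$, then $(f,g)_w=\sum_j\alpha_j a_jf_jb_j$ for some words $a_j,b_j$, $f_j\in S$, $\alpha_j\in\mathbb{C}$, where the greatest word of each $a_jf_jb_j$ is less than $w$. $S$ is symmetric if the two-sided ideal $\mathcal I$ it generates satisfies $\mathcal I^*=\mathcal I$. For $S$ closed under compositions, $BW$ is the set of words containing no $\hat s$ ($s\in S$) as a subword; it is a linear basis of $F_*/\mathcal{I}$, and $\mathrm{R}_S(f)$ is the unique element of the linear span of $BW$ with $f-\mathrm{R}_S(f)\in\mathcal{I}$. A symmetric $S$ closed under compositions is non-expanding if for all $u,v,w\in BW$ with $u\neq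 v$ and $ww^*\prec\mathrm{R}_S(uv^* )$ one has $w<u$ or $w<v$. It is strictly non-expanding if in addition $dd^*\in BW$ for every $d\in BW$. A $*$-algebra is strictly non-expanding if it possesses a strictly non-expanding Gröbner basis, i.e. it is $*$-isomorphic to $F_*/\mathcal{I}$ (for some finite $m$ and some order on the generators) with $\mathcal{I}$ the ideal generated by some strictly non-expanding $S$. A $*$-algebra $A$ is $O^*$-representable if it is $*$-isomorphic to a $*$-subalgebra of the $*$-algebra $L(E)$ of (adjointable) linear operators acting on some pre-Hilbert space $E$, i.e. there is an injective $*$-homomorphism $A\to L(E)$; operators need not be bounded. *)

(* Defs.v *)
From HB Require Import structures.
From mathcomp Require Import all_boot all_order all_algebra.
From mathcomp Require Import finmap boolp classical_sets reals.
From mathcomp Require Import complex.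
From mathcomp Require Import monalg.

Set Implicit Arguments.
Unset Strict Implicit.
Unset Printing Implicit Defensive.

Import Order.TTheory GRing.Theory Num.Theory.
Local Open Scope ring_scope.
Local Open Scope quotient_scope.

(* Complex *-algebras, not assumed unital or nonzero (algType requires 1 != 0,
   but F_* modulo an ideal containing 1 is a legitimate quotient below). *)
HB.mixin Record isStarAlgebra (C : numClosedFieldType) A
    of GRing.Lmodule C A := {
  smul : A -> A -> A;
  smulA : associative smul;
  smulDl : left_distributive smul +%R;
  smulDr : right_distributive smul +%R;
  smulZl : forall (c : C) (x y : A), smul (c *: x) y = c *: smul x y;
  smulZr : forall (c : C) (x y : A), smul x (c *: y) = c *: smul x y;
  star : A -> A;
  starK : involutive star;
  starD : {morph star : x y / x + y};
  starZ : forall (c : C) (x : A), star (c *: x) = c^* *: star x;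
  starM : forall x y : A, star (smul x y) = smul (star y) (star x)
}.

#[short(type="starAlgType")]
HB.structure Definition StarAlgebra (C : numClosedFieldType) :=
  {A of GRing.Lmodule C A & isStarAlgebra C A}.

Definition star_morphism (C : numClosedFieldType) (A B : starAlgType C)
    (phi : A -> B) : Prop :=
  [/\ linear phi, {morph phi : x y / smul x y} & {morph phi : x / star x}].

Definition star_isomorphic (C : numClosedFieldType) (A B : starAlgType C) :
    Prop :=
  exists phi : A -> B, star_morphism phi /\ bijective phi.

Section StarAlgebraTheory.
Variables (C : numClosedFieldType) (A : starAlgType C).
Implicit Types x y z : A.

Lemma starN x : star (- x) = - star x.
Proof. by rewrite -scaleN1r starZ rmorphN rmorph1 scaleN1r. Qed.

Lemma starB x y : star (x - y) = star x - star y.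
Proof. by rewrite starD starN. Qed.

Lemma smulBl x y z : smul (x - y) z = smul x z - smul y z.
Proof. by rewrite smulDl -scaleN1r smulZl scaleN1r. Qed.

Lemma smulBr x y z : smul x (y - z) = smul x y - smul x z.
Proof. by rewrite smulDr -scaleN1r smulZr scaleN1r. Qed.

End StarAlgebraTheory.

Definition two_sided_ideal (C : numClosedFieldType) (A : starAlgType C)
    (I : set A) : Prop :=
  [/\ I 0, forall (c : C) x y, I x -> I y -> I (c *: x + y)
    & forall a x, I x -> I (smul a x) /\ I (smul x a)].

Definition ideal_gen (C : numClosedFieldType) (A : starAlgType C)
    (S : set A) : set A :=
  smallest (@two_sided_ideal C A) S.

HB.mixin Record isStarIdeal (C : numClosedFieldType) (A : starAlgType C)
    (I : A -> bool) := {
  star_idealZ : forall (c : C) (x : A), x \in I -> c *: x \in I;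
  star_ideal_mull : forall a x : A, x \in I -> smul a x \in I;
  star_ideal_mulr : forall a x : A, x \in I -> smul x a \in I;
  star_ideal_star : forall x : A, x \in I -> star x \in I
}.

#[short(type="starIdeal")]
HB.structure Definition StarIdeal (C : numClosedFieldType)
    (A : starAlgType C) :=
  {I of GRing.ZmodClosed A I & isStarIdeal C A I}.

Section StarQuotient.
Variables (C : numClosedFieldType) (A : starAlgType C) (I : starIdeal A).

Definition starQuot : Type := Quotient.quot I.
HB.instance Definition _ := EqQuotient.on starQuot.
HB.instance Definition _ := GRing.Zmodule.on starQuot.

Local Notation Q := starQuot.

Definition quot_pi (x : A) : Q := \pi_(Quotient.quot I) x.
Definition quot_repr (u : Q) : A := repr (u : Quotient.quot I).

Lemma quot_reprK : cancel quot_repr quot_pi.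
Proof. by move=> u; exact: reprK. Qed.

Lemma quot_piP (x y : A) : (quot_pi x = quot_pi y) <-> (x - y \in I).
Proof. by rewrite Quotient.idealrBE; split => [/eqP|/eqP]. Qed.

Lemma quot_piD (x y : A) : quot_pi (x + y) = quot_pi x + quot_pi y.
Proof. exact: (@Quotient.pi_add A I x y). Qed.

Lemma quot_repr_pi (x : A) : quot_repr (quot_pi x) - x \in I.
Proof. by apply/quot_piP; rewrite quot_reprK. Qed.

Definition quot_mul (u v : Q) : Q := quot_pi (smul (quot_repr u) (quot_repr v)).
Definition quot_scale (c : C) (u : Q) : Q := quot_pi (c *: quot_repr u).
Definition quot_star (u : Q) : Q := quot_pi (star (quot_repr u)).

Lemma quot_piM (x y : A) :
  quot_pi (smul x y) = quot_mul (quot_pi x) (quot_pi y).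
Proof.
apply/esym/quot_piP.
set x' := quot_repr _; set y' := quot_repr _.
have -> : smul x' y' - smul x y = smul (x' - x) y' + smul x (y' - y).
  by rewrite smulBl smulBr addrA subrK.
apply: rpredD; first by apply: star_ideal_mulr; exact: quot_repr_pi.
by apply: star_ideal_mull; exact: quot_repr_pi.
Qed.

Lemma quot_piZ c (x : A) : quot_pi (c *: x) = quot_scale c (quot_pi x).
Proof. by apply/esym/quot_piP; rewrite -scalerBr star_idealZ // quot_repr_pi. Qed.

Lemma quot_pi_star (x : A) : quot_pi (star x) = quot_star (quot_pi x).
Proof.
by apply/esym/quot_piP; rewrite -starB star_ideal_star // quot_repr_pi.
Qed.

Let pE := (quot_piM, quot_piZ, quot_piD, quot_pi_star).

Lemma quot_ind (P : Q -> Prop) : (forall x, P (quot_pi x)) -> forall u, P u.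
Proof. by move=> h u; rewrite -[u]quot_reprK. Qed.

Fact quot_scaleA c d (u : Q) :
  quot_scale c (quot_scale d u) = quot_scale (c * d) u.
Proof. by elim/quot_ind: u => x; rewrite -!pE scalerA. Qed.

Fact quot_scale1 : left_id 1 quot_scale.
Proof. by elim/quot_ind => x; rewrite -!pE scale1r. Qed.

Fact quot_scaleDr : right_distributive quot_scale +%R.
Proof.
by move=> c; elim/quot_ind => x; elim/quot_ind => y; rewrite -!pE scalerDr.
Qed.

Fact quot_scaleDl (u : Q) : {morph quot_scale^~ u : c d / c + d}.
Proof. by move=> c d; elim/quot_ind: u => x; rewrite -!pE scalerDl. Qed.

HB.instance Definition _ := GRing.Zmodule_isLmodule.Build C starQuot
  quot_scaleA quot_scale1 quot_scaleDr quot_scaleDl.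

Lemma quot_scaleE c (u : Q) : c *: u = quot_scale c u.
Proof. by []. Qed.

Fact quot_mulA : associative quot_mul.
Proof.
elim/quot_ind => x; elim/quot_ind => y; elim/quot_ind => z.
by rewrite -!pE smulA.
Qed.

Fact quot_mulDl : left_distributive quot_mul +%R.
Proof.
elim/quot_ind => x; elim/quot_ind => y; elim/quot_ind => z.
by rewrite -!pE smulDl.
Qed.

Fact quot_mulDr : right_distributive quot_mul +%R.
Proof.
elim/quot_ind => x; elim/quot_ind => y; elim/quot_ind => z.
by rewrite -!pE smulDr.
Qed.

Fact quot_mulZl c (u v : Q) : quot_mul (c *: u) v = c *: quot_mul u v.
Proof.
elim/quot_ind: u => x; elim/quot_ind: v => y.
by rewrite !quot_scaleE -!pE smulZl.
Qed.

Fact quot_mulZr c (u v : Q) : quot_mul u (c *: v) = c *: quot_mul u v.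
Proof.
elim/quot_ind: u => x; elim/quot_ind: v => y.
by rewrite !quot_scaleE -!pE smulZr.
Qed.

Fact quot_starK : involutive quot_star.
Proof. by elim/quot_ind => x; rewrite -!pE starK. Qed.

Fact quot_starD : {morph quot_star : u v / u + v}.
Proof. by elim/quot_ind => x; elim/quot_ind => y; rewrite -!pE starD. Qed.

Fact quot_starZ c (u : Q) : quot_star (c *: u) = c^* *: quot_star u.
Proof. by elim/quot_ind: u => x; rewrite !quot_scaleE -!pE starZ. Qed.

Fact quot_starM (u v : Q) :
  quot_star (quot_mul u v) = quot_mul (quot_star v) (quot_star u).
Proof. by elim/quot_ind: u => x; elim/quot_ind: v => y; rewrite -!pE starM. Qed.

HB.instance Definition _ := isStarAlgebra.Build C starQuot
  quot_mulA quot_mulDl quot_mulDr quot_mulZl quot_mulZr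
  quot_starK quot_starD quot_starZ quot_starM.

Lemma quot_pi_star_morphism : star_morphism quot_pi.
Proof.
split.
- by move=> c x y; rewrite quot_piD quot_piZ.
- by move=> x y; rewrite quot_piM.
- by move=> x; rewrite quot_pi_star.
Qed.

End StarQuotient.

(* The *-algebra L(E) of adjointable operators on the pre-Hilbert space
   (E, form). The adjoint is uniquely determined by the operator
   (adjointable_inj), so carrying it as a field adds no data. *)
Record adjointable (C : numClosedFieldType) (E : lmodType C)
    (form : {dot E for (@Num.conj C)}) := Adjointable {
  adj_op :> E -> E;
  adj_adj : E -> E;
  adj_op_linear : linear adj_op;
  adj_adj_linear : linear adj_adj;
  adj_opP : forall x y, form (adj_op x) y = form x (adj_adj y)
}.

Section Adjointable.
Variables (C : numClosedFieldType) (E : lmodType C).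
Variable form : {dot E for (@Num.conj C)}.
Implicit Types S T U : adjointable form.
Local Notation "''[' x , y ]" := (form x y).

Lemma form_Dl x y z : '[x + y, z] = '[x, z] + '[y, z].
Proof. exact: linearDl. Qed.

Lemma form_Dr x y z : '[x, y + z] = '[x, y] + '[x, z].
Proof. exact: linearDr. Qed.

Lemma form_Zl c x y : '[c *: x, y] = c * '[x, y].
Proof. exact: linearZl_LR. Qed.

Lemma form_Zr c x y : '[x, c *: y] = c^* * '[x, y].
Proof. by rewrite linearZr. Qed.

Lemma form_C x y : '[x, y] = ('[y, x])^*.
Proof. by rewrite (hermitian_subproof x y) expr0 mul1r. Qed.

Lemma form_ext x y : (forall z, '[z, x] = '[z, y]) -> x = y.
Proof.
move=> h; apply/eqP; rewrite -subr_eq0; apply/negPn/negP => nz.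
have form_xy : '[x - y, x - y] = 0.
  by rewrite -scaleN1r form_Dr form_Zr rmorphN rmorph1 mulN1r h subrr.
have : 0 < '[x - y, x - y] by exact: neq0_dnorm_gt0.
by rewrite form_xy ltxx.
Qed.

Lemma adjointable_inj : injective (@adj_op C E form).
Proof.
move=> [f f' lf lf' fP] [g g' lg lg' gP] /= efg.
rewrite efg in lf fP *.
have efg' : f' = g'.
  by apply: funext => y; apply: form_ext => z; rewrite -fP gP.
rewrite efg' in lf' fP *.
by congr Adjointable; exact: Prop_irrelevance.
Qed.

HB.instance Definition _ := gen_eqMixin (adjointable form).
HB.instance Definition _ := gen_choiceMixin (adjointable form).

Lemma adj_ext S T : (forall x, S x = T x) -> S = T.
Proof. by move=> h; apply: adjointable_inj; exact: funext. Qed.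

Fact adj_zero_subproof x y : '[0, y] = '[x, 0 : E].
Proof.
by rewrite -(scale0r (0 : E)) form_Zl form_Zr rmorph0 !mul0r.
Qed.

Fact adj_cst0_linear : linear (fun _ : E => 0 : E).
Proof. by move=> c x y; rewrite scaler0 addr0. Qed.

Definition adj_zero : adjointable form :=
  Adjointable adj_cst0_linear adj_cst0_linear adj_zero_subproof.

Fact adj_add_linear (f g : E -> E) : linear f -> linear g ->
  linear (fun x => f x + g x).
Proof. by move=> lf lg c x y; rewrite lf lg scalerDr addrACA. Qed.

Fact adj_add_subproof S T x y :
  '[S x + T x, y] = '[x, adj_adj S y + adj_adj T y].
Proof. by rewrite form_Dl form_Dr !adj_opP. Qed.

Definition adj_add S T : adjointable form :=
  Adjointable (adj_add_linear (adj_op_linear S) (adj_op_linear T))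
              (adj_add_linear (adj_adj_linear S) (adj_adj_linear T))
              (adj_add_subproof S T).

Fact adj_scale_linear (d : C) (f : E -> E) : linear f ->
  linear (fun x => d *: f x).
Proof. by move=> lf c x y; rewrite lf scalerDr !scalerA mulrC. Qed.

Fact adj_scale_subproof (c : C) T x y :
  '[c *: T x, y] = '[x, c^* *: adj_adj T y].
Proof. by rewrite form_Zl form_Zr conjCK adj_opP. Qed.

Definition adj_scale (c : C) T : adjointable form :=
  Adjointable (adj_scale_linear c (adj_op_linear T))
              (adj_scale_linear c^* (adj_adj_linear T))
              (adj_scale_subproof c T).

Fact adj_comp_linear (f g : E -> E) : linear f -> linear g ->
  linear (fun x => f (g x)).
Proof. by move=> lf lg c x y; rewrite lg lf. Qed.

Fact adj_mul_subproof S T x y :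
  '[S (T x), y] = '[x, adj_adj T (adj_adj S y)].
Proof. by rewrite !adj_opP. Qed.

Definition adj_mul S T : adjointable form :=
  Adjointable (adj_comp_linear (adj_op_linear S) (adj_op_linear T))
              (adj_comp_linear (adj_adj_linear T) (adj_adj_linear S))
              (adj_mul_subproof S T).

Fact adj_star_subproof T x y : '[adj_adj T x, y] = '[x, T y].
Proof. by rewrite form_C -adj_opP -form_C. Qed.

Definition adj_star T : adjointable form :=
  Adjointable (adj_adj_linear T) (adj_op_linear T) (adj_star_subproof T).

Fact adj_addA : associative adj_add.
Proof. by move=> S T U; apply: adj_ext => x /=; rewrite addrA. Qed.

Fact adj_addC : commutative adj_add.
Proof. by move=> S T; apply: adj_ext => x /=; rewrite addrC. Qed.

Fact adj_add0 : left_id adj_zero adj_add.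
Proof. by move=> S; apply: adj_ext => x /=; rewrite add0r. Qed.

Fact adj_addN : left_inverse adj_zero (adj_scale (-1)) adj_add.
Proof. by move=> S; apply: adj_ext => x /=; rewrite scaleN1r addNr. Qed.

HB.instance Definition _ := GRing.isZmodule.Build (adjointable form)
  adj_addA adj_addC adj_add0 adj_addN.

Fact adj_scaleA c d T : adj_scale c (adj_scale d T) = adj_scale (c * d) T.
Proof. by apply: adj_ext => x /=; rewrite scalerA. Qed.

Fact adj_scale1 : left_id 1 adj_scale.
Proof. by move=> T; apply: adj_ext => x /=; rewrite scale1r. Qed.

Fact adj_scaleDr : right_distributive adj_scale +%R.
Proof. by move=> c S T; apply: adj_ext => x /=; rewrite scalerDr. Qed.

Fact adj_scaleDl T : {morph adj_scale^~ T : c d / c + d}.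
Proof. by move=> c d; apply: adj_ext => x /=; rewrite scalerDl. Qed.

HB.instance Definition _ := GRing.Zmodule_isLmodule.Build C (adjointable form)
  adj_scaleA adj_scale1 adj_scaleDr adj_scaleDl.

Fact adj_mulA : associative adj_mul.
Proof. by move=> S T U; exact: adj_ext. Qed.

Fact adj_mulDl : left_distributive adj_mul +%R.
Proof. by move=> S T U; exact: adj_ext. Qed.

Fact adj_mulDr : right_distributive adj_mul +%R.
Proof.
move=> S T U; apply: adj_ext => x /=.
by have := adj_op_linear S 1 (T x) (U x); rewrite !scale1r.
Qed.

Fact adj_mulZl c S T : adj_mul (c *: S) T = c *: adj_mul S T.
Proof. exact: adj_ext. Qed.

Fact adj_mulZr c S T : adj_mul S (c *: T) = c *: adj_mul S T.
Proof.
apply: adj_ext => x /=.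
have S0 : S 0 = 0.
  by have := adj_op_linear S (-1) 0 0; rewrite scaler0 addr0 scaleN1r addNr.
by have := adj_op_linear S c (T x) 0; rewrite S0 !addr0.
Qed.

Fact adj_starK : involutive adj_star.
Proof. by move=> T; exact: adj_ext. Qed.

Fact adj_starD : {morph adj_star : S T / S + T}.
Proof. by move=> S T; exact: adj_ext. Qed.

Fact adj_starZ c T : adj_star (c *: T) = c^* *: adj_star T.
Proof. exact: adj_ext. Qed.

Fact adj_starM S T :
  adj_star (adj_mul S T) = adj_mul (adj_star T) (adj_star S).
Proof. exact: adj_ext. Qed.

HB.instance Definition _ := isStarAlgebra.Build C (adjointable form)
  adj_mulA adj_mulDl adj_mulDr adj_mulZl adj_mulZr
  adj_starK adj_starD adj_starZ adj_starM.

End Adjointable.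

Definition O_star_representable (C : numClosedFieldType) (A : starAlgType C) :
    Prop :=
  exists (E : lmodType C) (form : {dot E for (@Num.conj C)})
         (phi : A -> adjointable form),
    star_morphism phi /\ injective phi.

(* (j, false) is x_j and (j, true) is x_j^*. *)
Definition gen (m : nat) : Type := ('I_m * bool)%type.
HB.instance Definition _ m := Finite.on (gen m).

Definition gen_star m (x : gen m) : gen m := (x.1, ~~ x.2).

Notation word m := {fmonom (gen m)}.

Definition word_star m (w : word m) : word m := FMonom (rev (map (@gen_star m) w)).

Lemma word_starK m : involutive (@word_star m).
Proof.
case=> w; congr FMonom; rewrite /= map_rev revK -map_comp.
by rewrite -[RHS]map_id; apply: eq_map => -[i b] /=; rewrite /gen_star /= negbK.
Qed.

Lemma word_starM m (u v : word m) :
  word_star (mmul u v) = mmul (word_star v) (word_star u).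
Proof.
by case: u v => [u] [v]; rewrite /word_star /mmul /= !fmmulE /= map_cat rev_cat.
Qed.

Notation freeStarAlg C m := {malg C[word m]}.

Section FreeStarAlgebra.
Variables (C : numClosedFieldType) (m : nat).
Local Notation F := (freeStarAlg C m).
Implicit Types f g : F.

Definition free_star f : F :=
  \sum_(z <- msupp f) << (f@_z)^* *g word_star z >>.

Lemma mcoeff_free_star f z : (free_star f)@_z = (f@_(word_star z))^*.
Proof.
rewrite raddf_sum /=.
have [zf|zf] := boolP (word_star z \in msupp f).
  rewrite (big_fsetD1 (word_star z)) //= mcoeffU word_starK eqxx mulr1n.
  rewrite big1_fset ?addr0 // => y; rewrite in_fsetD1 => /andP[yz _] _.
  by rewrite mcoeffU -(can_eq (@word_starK m)) word_starK (negbTE yz).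
rewrite (mcoeff_outdom zf) rmorph0 big1_fset // => y yf _.
rewrite mcoeffU; case: eqP => // yz; move: zf.
by rewrite -yz word_starK yf.
Qed.

Fact free_starK : involutive free_star.
Proof.
by move=> f; apply/malgP => z; rewrite !mcoeff_free_star word_starK conjCK.
Qed.

Fact free_starD : {morph free_star : f g / f + g}.
Proof.
by move=> f g; apply/malgP => z; rewrite !(mcoeffD, mcoeff_free_star) rmorphD.
Qed.

Fact free_starZ (c : C) f : free_star (c *: f) = c^* *: free_star f.
Proof.
by apply/malgP => z; rewrite !(mcoeffZ, mcoeff_free_star) rmorphM.
Qed.

Lemma free_starU (c : C) (z : word m) :
  free_star << c *g z >> = << c^* *g word_star z >>.
Proof.
apply/malgP => y; rewrite mcoeff_free_star !mcoeffU rmorphMn.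
by congr (_ *+ _); rewrite -[in RHS](can_eq (@word_starK m)) word_starK.
Qed.

Fact free_mulZl (c : C) f g : (c *: f) * g = c *: (f * g).
Proof. by rewrite scalerAl. Qed.

Fact free_mulZr (c : C) f g : f * (c *: g) = c *: (f * g).
Proof.
rewrite -!mul_malgC !mulrA; congr (_ * _).
rewrite !malgM_def fgmulgU fgmulUg.
by apply: eq_bigr => k _; rewrite mul1m mulm1 mulrC.
Qed.

Fact free_starM f g : free_star (f * g) = free_star g * free_star f.
Proof.
have sum_star (I : Type) (r : seq I) (P : pred I) (h : I -> F) :
    free_star (\sum_(i <- r | P i) h i) = \sum_(i <- r | P i) free_star (h i).
  apply: (big_morph free_star free_starD).
  by apply/malgP => z; rewrite mcoeff_free_star !mcoeff0 rmorph0.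
rewrite malgME sum_star.
rewrite [in RHS]/free_star mulr_sumr; apply: eq_bigr => k _.
rewrite sum_star mulr_suml; apply: eq_bigr => l _.
rewrite free_starU malgM_def fgmulUU word_starM rmorphM mulrC.
by [].
Qed.

HB.instance Definition _ := isStarAlgebra.Build C F
  (@mulrA F) (@mulrDl F) (@mulrDr F) free_mulZl free_mulZr
  free_starK free_starD free_starZ free_starM.

End FreeStarAlgebra.

Definition linear_order (T : Type) (le : rel T) : Prop :=
  [/\ reflexive le, antisymmetric le, transitive le & total le].

Section GroebnerBases.
Variables (C : numClosedFieldType) (m : nat) (le : rel (gen m)).
Local Notation W := (word m).
Local Notation F := (freeStarAlg C m).
Implicit Types (u v w z : W) (f g : F) (S : set F).

Fixpoint lex_lt (s t : seq (gen m)) : bool :=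
  match s, t with
  | x :: s', y :: t' => if x == y then lex_lt s' t' else le x y
  | _, _ => false
  end.

Definition word_lt u v : bool :=
  (size u < size v)%N || ((size u == size v) && lex_lt u v).

(* The empty word is the least word; only lead f for f != 0 is meaningful. *)
Definition lead f : W :=
  \big[(fun u v => if word_lt u v then v else u)/mone]_(z <- msupp f) z.

Definition lcoeff f : C := f@_(lead f).

Definition composition f g (x z : W) : F :=
  lcoeff g *: (f * << z >>) - lcoeff f *: (<< x >> * g).

Definition closed_under_compositions S : Prop :=
  [/\ forall f, S f -> f != 0,
      forall f g, S f -> S g -> f != g -> ~~ infix (lead f) (lead g)
    & forall f g, S f -> S g ->
      forall x y z : W, y != mone ->
        lead f = mmul x y -> lead g = mmul y z ->
      exists (n : nat) (al : 'I_n -> C) (a b : 'I_n -> W) (s : 'I_n -> F),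
        (forall j, S (s j) /\
          word_lt (lead (<< a j >> * s j * << b j >>)) (mmul (mmul x y) z)) /\
        composition f g x z =
          \sum_(j < n) al j *: (<< a j >> * s j * << b j >>)].

Definition symmetric_set S : Prop :=
  [set star f | f in ideal_gen S]%classic = ideal_gen S.

Definition BW S : set W := [set w | forall s, S s -> ~~ infix (lead s) w]%classic.

(* When S is closed under compositions, the set below is a singleton. *)
Definition normal_form S f : F :=
  xget 0 [set r | (forall z, z \in msupp r -> BW S z) /\
                  ideal_gen S (f - r)]%classic.

Definition non_expanding S : Prop :=
  [/\ symmetric_set S, closed_under_compositions S
    & forall u v w, BW S u -> BW S v -> BW S w -> u != v ->
        mmul w (word_star w) \in
          msupp (normal_form S << mmul u (word_star v) >>) ->
        word_lt w u \/ word_lt w v].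

Definition strictly_non_expanding S : Prop :=
  non_expanding S /\ forall d, BW S d -> BW S (mmul d (word_star d)).

End GroebnerBases.

Definition strictly_non_expanding_algebra (C : numClosedFieldType)
    (A : starAlgType C) : Prop :=
  exists (m : nat) (le : rel (gen m)) (S : set (freeStarAlg C m))
         (I : starIdeal (freeStarAlg C m)),
    [/\ linear_order le, strictly_non_expanding le S,
        (forall f, (f \in I) <-> ideal_gen S f)
      & star_isomorphic A (starQuot I)].

(* Main.v *)
From HB Require Import structures.
Require Import Defs.
From mathcomp Require Import all_boot all_order all_algebra.
From mathcomp Require Import finmap boolp classical_sets reals complex monalg.
From mathcomp Require Import zify ring.

Set Implicit Arguments.
Unset Strict Implicit.
Unset Printing Implicit Defensive.

Import Order.TTheory GRing.Theory Num.Theory.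
Local Open Scope ring_scope.

(** Let [I] be the ideal generated by a strictly non-expanding set [S].  By the
GNS construction ([gns_representable], [quotient_representable]) it is enough
to find a linear functional [tau] on the free *-algebra that vanishes on [I],
satisfies [tau f^* = (tau f)^*], and is faithful: [0 < tau (f f^* )] for every
[f] outside [I].

Such a [tau] is built from positive numbers [a_w], one for each word [w]: take
the normal form of [f], send every reduced word [w w^*] to [a_w] and all other
reduced words to [0], and symmetrize the result under [f |-> f^*].  For this to
be linear and to vanish on [I], normal forms must be unique, which is the
composition lemma ([composition_lemma]).

It remains to choose the [a_w] so that the Gram matrix [tau (u v^* )], with
[u] and [v] ranging over the reduced words, is positive definite.  The
hypotheses on [S] make this a triangular problem.  Because [u u^*] is reduced,
the diagonal entry at [u] is exactly [a_u] ([gram_diag]).  Because [S] is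
non-expanding, for [u != v] the entry at [(u, v)] depends only on the numbers
[a_w] with [w] smaller than [u] or [v] ([gram_local]).  The words below a given
one are finite in number, so they can be numbered in increasing order
([word_rank]), and the [a_w] can be chosen one after the other, each so large
that its diagonal entry dominates all the off-diagonal entries that are already
determined ([growing_weights], [dominated_form_ge]). *)

(** * Positive functionals and pre-Hilbert representations *)

Section StarFunctional.
Variables (C : numClosedFieldType) (A : starAlgType C).
Implicit Types x y : A.

Lemma star0 : star (0 : A) = 0.
Proof. by rewrite -[X in star X](scale0r (0 : A)) starZ rmorph0 scale0r. Qed.

Lemma smul0l x : smul 0 x = 0.
Proof. by rewrite -[X in smul X _](scale0r (0 : A)) smulZl scale0r. Qed.

Lemma smul0r x : smul x 0 = 0.
Proof. by rewrite -[X in smul _ X](scale0r (0 : A)) smulZr scale0r. Qed.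

Variable tau : A -> C.
Hypothesis tau_lin : forall c x y, tau (c *: x + y) = c * tau x + tau y.

Lemma tau0 : tau 0 = 0.
Proof. by have := tau_lin (-1) 0 0; rewrite scaler0 addr0 mulN1r addNr. Qed.

Lemma tauD x y : tau (x + y) = tau x + tau y.
Proof. by rewrite -[x]scale1r tau_lin mul1r scale1r. Qed.

(** A functional that vanishes on an ideal sees [x x^*] only modulo the ideal,
as [x x^* - y y^* = (x - y) x^* + y (x - y)^*]. *)
Lemma star_square_mod x y :
  tau (smul (x - y) (star x)) = 0 -> tau (smul y (star (x - y))) = 0 ->
  tau (smul x (star x)) = tau (smul y (star y)).
Proof.
move=> t1 t2; rewrite -[RHS]add0r -t2 -[RHS]add0r -t1 -!tauD.
by rewrite starB smulBl smulBr !subrK.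
Qed.

Lemma tau_sum n (c : 'I_n -> C) (x : 'I_n -> A) :
  tau (\sum_i c i *: x i) = \sum_i c i * tau (x i).
Proof.
apply: (big_ind2 (fun y t => tau y = t)) => [|x1 _ x2 _ <- <-|i _].
  exact: tau0.
  exact: tauD.
by rewrite -[_ *: _]addr0 tau_lin tau0 addr0.
Qed.

Lemma star_square_sum n (c : nat -> C) (x : nat -> A) :
  let f := \sum_(i < n) c i *: x i in
  tau (smul f (star f)) =
    \sum_(i < n) \sum_(j < n) c i * (c j)^* * tau (smul (x i) (star (x j))).
Proof.
move=> f; have eL : smul f (star f) = \sum_(i < n) c i *: smul (x i) (star f).
  rewrite {1}/f.
  apply: (big_ind2 (fun y t => smul y _ = t)) => [|x1 _ x2 _ <- <-|i _].
  - exact: smul0l.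
  - exact: smulDl.
  - exact: smulZl.
rewrite eL tau_sum; apply: eq_bigr => i _.
have -> : smul (x i) (star f) =
    \sum_(j < n) (c j)^* *: smul (x i) (star (x j)).
  rewrite /f.
  apply: (big_ind2 (fun y t => smul _ (star y) = t)) => [|x1 _ x2 _ <- <-|j _].
  - by rewrite star0 smul0r.
  - by rewrite starD smulDr.
  - by rewrite starZ smulZr.
by rewrite tau_sum mulr_sumr; apply: eq_bigr => j _; rewrite mulrA.
Qed.

End StarFunctional.

Section GNS.
Variables (C : numClosedFieldType) (A : starAlgType C) (tau : A -> C).
Hypothesis tau_lin : forall c x y, tau (c *: x + y) = c * tau x + tau y.
Hypothesis tau_star : forall x, tau (star x) = (tau x)^*.
Hypothesis tau_pos : forall x, x != 0 -> 0 < tau (smul x (star x)).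

(** With [star y] on the left, multiplication by [a] on the left has the
multiplication by [star a] as its adjoint. *)
Definition gns_form (x y : A) : C := tau (smul (star y) x).

Lemma gns_form_bilinear :
  bilinear_for (GRing.Scale.Law.clone _ _ ( *%R ) _)
    (GRing.Scale.Law.clone _ _ (@Num.conj C \; *%R) _) gns_form.
Proof.
split=> u c x y; rewrite /gns_form /=.
  by rewrite smulDr smulZr tau_lin.
by rewrite starD starZ smulDl smulZl tau_lin.
Qed.

HB.instance Definition _ := bilinear_isBilinear.Build C A A C
  (GRing.Scale.Law.clone _ _ ( *%R ) _)
  (GRing.Scale.Law.clone _ _ (@Num.conj C \; *%R) _) gns_form gns_form_bilinear.

Lemma gns_form_hermitian x y :
  gns_form x y = (-1) ^+ false * Num.conj (gns_form y x).
Proof. by rewrite expr0 mul1r /gns_form -tau_star starM starK. Qed.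

HB.instance Definition _ := isHermitianSesquilinear.Build C A false
  (@Num.conj C) gns_form gns_form_hermitian.

Lemma gns_form_pos x : x != 0 -> 0 < gns_form x x.
Proof.
move=> x0; rewrite /gns_form -{2}[x]starK; apply: tau_pos.
apply: contra_neq x0 => sx0.
by rewrite -[x]starK sx0 star0.
Qed.

HB.instance Definition _ := isDotProduct.Build C A gns_form gns_form_pos.

Lemma gns_smul_linear a : linear (smul a : A -> A).
Proof. by move=> c x y; rewrite smulDr smulZr. Qed.

Lemma gns_smul_adj a x y : gns_form (smul a x) y = gns_form x (smul (star a) y).
Proof. by rewrite /gns_form starM starK smulA. Qed.

Definition gns_rep (a : A) : adjointable gns_form :=
  Adjointable (gns_smul_linear a) (gns_smul_linear (star a)) (gns_smul_adj a).

(** The representation acts on [A] itself.  It is injective even when [A] has no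
unit: if [x] and [y] act in the same way, then [(x - y) (x - y)^* = 0], and
[tau_pos] forces [x = y]. *)
Lemma gns_representable : O_star_representable A.
Proof.
exists A, (gns_form : {dot A for @Num.conj C}), gns_rep; split.
  split=> [c x y|x y|x]; apply: adj_ext => z //=.
    by rewrite smulDl smulZl.
  by rewrite smulA.
move=> x y exy; apply/eqP; rewrite -subr_eq0; apply/negPn/negP => /tau_pos.
have /= h : gns_rep x (star (x - y)) = gns_rep y (star (x - y)) by rewrite exy.
by rewrite smulBl h subrr (tau0 tau_lin) ltxx.
Qed.

End GNS.

Lemma linear_map0 (K : nzRingType) (U V : lmodType K) (f : U -> V) :
  linear f -> f 0 = 0.
Proof.
by move=> f_lin; have := f_lin (-1) 0 0; rewrite scaler0 addr0 scaleN1r addNr.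
Qed.

Section QuotientRepresentation.
Variables (C : numClosedFieldType) (B : starAlgType C) (I : starIdeal B).
Variable tau : B -> C.
Hypothesis tau_lin : forall c x y, tau (c *: x + y) = c * tau x + tau y.
Hypothesis tau_star : forall x, tau (star x) = (tau x)^*.
Hypothesis tau_ideal : forall x, x \in I -> tau x = 0.
Hypothesis tau_pos : forall x, x \notin I -> 0 < tau (smul x (star x)).

Lemma quotient_representable (A : starAlgType C) :
  star_isomorphic A (starQuot I) -> O_star_representable A.
Proof.
move=> [phi [[phi_lin phiM phi_star] phi_bij]].
have [pi_lin piM pi_star] := quot_pi_star_morphism I.
pose r x := quot_repr (phi x).
have rP x : quot_pi I (r x) = phi x by exact: quot_reprK.
have tau_pi x y : quot_pi I x = quot_pi I y -> tau x = tau y.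
  move=> /quot_piP /tau_ideal xy; rewrite -[x](subrK y) -[x - y]scale1r.
  by rewrite tau_lin xy mulr0 add0r.
apply: (@gns_representable C A (fun x => tau (r x))).
- move=> c x y; rewrite -tau_lin; apply: tau_pi.
  by rewrite pi_lin !rP phi_lin.
- by move=> x; rewrite -tau_star; apply: tau_pi; rewrite pi_star !rP phi_star.
move=> x x0.
have -> : tau (r (smul x (star x))) = tau (smul (r x) (star (r x))).
  by apply: tau_pi; rewrite piM pi_star !rP phiM phi_star.
apply: tau_pos; apply: contra_neqN x0 => rxI.
apply: (bij_inj phi_bij); rewrite -rP (linear_map0 phi_lin).
rewrite -(linear_map0 pi_lin).
by apply/quot_piP; rewrite subr0.
Qed.

End QuotientRepresentation.

(** * The length-lexicographic order on words *)

Section WordOrder.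
Variables (m : nat) (le : rel (gen m)).
Hypothesis le_linear : linear_order le.
Local Notation W := (word m).
Implicit Types u v w a b : W.

Lemma word_mulE u v : mmul u v = u ++ v :> seq (gen m).
Proof. exact: fmM. Qed.

Lemma word_inj u v : u = v :> seq (gen m) -> u = v.
Proof. exact: val_inj. Qed.

Lemma word_mulI a b u v : mmul (mmul a u) b = mmul (mmul a v) b -> u = v.
Proof.
move=> /(congr1 (@fmonom_val _)); rewrite !word_mulE => e.
have sz : size u = size v.
  by move/(congr1 size): e; rewrite !size_cat; lia.
move/eqP: e; rewrite eqseq_cat ?size_cat ?sz // => /andP[/eqP e _].
move/eqP: e; rewrite eqseq_cat // => /andP[_ /eqP e].
exact: word_inj.
Qed.

Lemma lex_irr s : lex_lt le s s = false.
Proof. by elim: s => //= x s ->; rewrite eqxx. Qed.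

Lemma lex_trans s t r : lex_lt le s t -> lex_lt le t r -> lex_lt le s r.
Proof.
have [_ leA leT _] := le_linear.
elim: s t r => [|x s IH] [|y t] [|z r] //=.
have [->|xy] := eqVneq x y; first by case: eqP => // _; exact: IH.
have [<-|yz] := eqVneq y z; first by rewrite (negbTE xy).
have [<-|xz] := eqVneq x z; last exact: leT.
by move=> lxy lyx; case/eqP: xy; apply: leA; rewrite lxy lyx.
Qed.

Lemma lex_total s t :
  size s = size t -> s != t -> lex_lt le s t || lex_lt le t s.
Proof.
have [_ _ _ leTot] := le_linear.
elim: s t => [|x s IH] [|y t] //= [sz].
rewrite eqseq_cons; case: (eqVneq x y) => [_|xy] /=; first exact: IH.
by rewrite leTot.
Qed.

Lemma lex_catl s t r : lex_lt le (r ++ s) (r ++ t) = lex_lt le s t.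
Proof. by elim: r => //= x r ->; rewrite eqxx. Qed.

(** On the right the sizes must agree: a proper prefix is never smaller. *)
Lemma lex_catr s t r :
  size s = size t -> lex_lt le s t -> lex_lt le (s ++ r) (t ++ r).
Proof.
elim: s t => [|x s IH] [|y t] //= [sz].
by case: eqP => // _; exact: IH.
Qed.

Lemma word_lt_irr u : word_lt le u u = false.
Proof. by rewrite /word_lt ltnn eqxx lex_irr. Qed.

Lemma word_lt_trans : transitive (word_lt le).
Proof.
move=> v u w /orP[uv|/andP[/eqP uv luv]] /orP[vw|/andP[/eqP vw lvw]];
  apply/orP.
- by left; exact: ltn_trans vw.
- by left; rewrite -vw.
- by left; rewrite uv.
- by right; rewrite uv vw eqxx (lex_trans luv lvw).
Qed.

Lemma word_lt_total u v : u != v -> word_lt le u v || word_lt le v u.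
Proof.
move=> uv; rewrite /word_lt; case: ltngtP => //= sz.
by apply: lex_total => //; rewrite -fmP.
Qed.

Lemma word_lt_size u v : word_lt le u v -> (size u <= size v)%N.
Proof. by case/orP => [/ltnW//|/andP[/eqP->]]. Qed.

Lemma word_lt_mul a b u v :
  word_lt le u v -> word_lt le (mmul (mmul a u) b) (mmul (mmul a v) b).
Proof.
rewrite /word_lt !word_mulE !size_cat => /orP[h|/andP[/eqP sz h]]; apply/orP.
  by left; rewrite ltn_add2r ltn_add2l.
right; rewrite sz eqxx; apply: lex_catr; first by rewrite !size_cat sz.
by rewrite lex_catl.
Qed.

Definition words_upto n : seq W :=
  flatten [seq [seq FMonom (tval t) | t <- enum {: k.-tuple (gen m)}]
          | k <- iota 0 n.+1].

Lemma mem_words_upto n u : (size u <= n)%N -> u \in words_upto n.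
Proof.
move=> un; apply/flattenP.
exists [seq FMonom (tval t) | t <- enum {: (size u).-tuple (gen m)}].
  by apply/mapP; exists (size u) => //; rewrite mem_iota /=.
by apply/mapP; exists (in_tuple u); rewrite ?mem_enum // /= fmK.
Qed.

Definition words_below u : seq W :=
  undup [seq v <- words_upto (size u) | word_lt le v u].

(** The position of [u] in the increasing enumeration of all words.  It turns
the order on words into the order of [nat], so that well-founded recursion along
[word_lt] becomes induction on natural numbers. *)
Definition word_rank u : nat := size (words_below u).

Lemma mem_words_below u v : (v \in words_below u) = word_lt le v u.
Proof.
rewrite mem_undup mem_filter; have [lt_vu|//] := boolP (word_lt le v u).
by rewrite mem_words_upto // word_lt_size.
Qed.

Lemma word_rank_homo u v : word_lt le u v -> (word_rank u < word_rank v)%N.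
Proof.
move=> uv; have : uniq (u :: words_below u).
  by rewrite /= mem_words_below word_lt_irr undup_uniq.
move=> /uniq_leq_size; apply => w; rewrite inE !mem_words_below.
by case/orP => [/eqP->//|wu]; exact: word_lt_trans uv.
Qed.

Lemma word_rank_inj : injective word_rank.
Proof.
move=> u v e; apply/eqP/negPn/negP => /word_lt_total.
by case/orP => /word_rank_homo; rewrite e ltnn.
Qed.

Lemma word_rankE u v : word_lt le u v = (word_rank u < word_rank v)%N.
Proof.
apply/idP/idP => [|ruv]; first exact: word_rank_homo.
have : u != v by apply/eqP => uv; move: ruv; rewrite uv ltnn.
case/word_lt_total/orP => // /word_rank_homo /ltn_trans /(_ ruv).
by rewrite ltnn.
Qed.

Lemma word_rank1 : word_rank mone = 0%N.
Proof.
rewrite /word_rank; case e : (words_below mone) => [//|v s].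
have : v \in words_below mone by rewrite e mem_head.
rewrite mem_words_below /word_lt fm1 ltn0 /= size_eq0.
by case/andP => /eqP ->.
Qed.

Lemma word_rank_mul a b u v : (word_rank u < word_rank v)%N ->
  (word_rank (mmul (mmul a u) b) < word_rank (mmul (mmul a v) b))%N.
Proof. by rewrite -!word_rankE; exact: word_lt_mul. Qed.

End WordOrder.

(** * Leading words *)

(** The product [a f b]; locked because matching a product of {malg} elements up
to conversion unfolds the convolution sums. *)
HB.lock Definition sandwich (C : numClosedFieldType) (m : nat) (a b : word m)
    (f : freeStarAlg C m) : freeStarAlg C m := << a >> * f * << b >>.

Lemma mulr_assoc5 (K : nzRingType) (a a' x b b' : K) :
  a * (a' * x * b') * b = a * a' * x * (b' * b).
Proof. by rewrite !mulrA. Qed.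

Section Lead.
Variables (m : nat) (le : rel (gen m)).
Hypothesis le_linear : linear_order le.
Variable C : numClosedFieldType.
Local Notation W := (word m).
Local Notation F := (freeStarAlg C m).
Local Notation rk := (word_rank le).
Implicit Types (u v w a b z : W) (f g : F).

(** The default value [mone] of the iterated operator has rank 0 and so never
exceeds an entry of [s]; it can only be returned when [s] is empty or made of
empty words. *)
Lemma lead_seq (s : seq W) :
  let l := \big[(fun u v => if word_lt le u v then v else u)/mone]_(z <- s) z in
  (l = mone \/ l \in s) /\ forall z, z \in s -> (rk z <= rk l)%N.
Proof.
elim: s => [|x s [IHl IHs]] /=; first by rewrite big_nil; split; [left|].
rewrite big_cons; set l := \big[_/_]_(_ <- _) _ in IHl IHs *.
rewrite (word_rankE le_linear); case: ltnP => xl; split.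
- by case: IHl => [->|ls]; [left|right; rewrite inE ls orbT].
- by move=> z; rewrite inE => /orP[/eqP->|/IHs//]; exact: ltnW.
- by right; rewrite mem_head.
- by move=> z; rewrite inE => /orP[/eqP->//|/IHs zl]; exact: leq_trans xl.
Qed.

Lemma lead_max f z : z \in msupp f -> (rk z <= rk (lead le f))%N.
Proof. by case: (lead_seq (msupp f)) => _; apply. Qed.

Lemma lead_supp f : f != 0 -> lead le f \in msupp f.
Proof.
move=> f0; have /= [] := lead_seq (msupp f); rewrite -/(lead le f).
move=> [lf|//] lm.
have : msupp f != fset0 by rewrite msupp_eq0.
case/fset0Pn => z zf; have := lm z zf; rewrite lf word_rank1 leqn0.
by rewrite -(word_rank1 le) => /eqP/(word_rank_inj le_linear) <-.
Qed.

Lemma lcoeff_neq0 f : f != 0 -> lcoeff le f != 0.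
Proof. by move=> f0; rewrite /lcoeff mcoeff_neq0 lead_supp. Qed.

Lemma lead_eq f z : z \in msupp f ->
  (forall y, y \in msupp f -> (rk y <= rk z)%N) -> lead le f = z.
Proof.
move=> zf zmax; apply: (word_rank_inj le_linear); apply/eqP.
rewrite eqn_leq lead_max // zmax ?lead_supp //; apply: contraTneq zf => ->.
by rewrite msupp0.
Qed.

Lemma wordM u v : << u >> * << v >> = << mmul u v >> :> F.
Proof. by rewrite malgM_def fgmulUU mulr1. Qed.

Lemma word1 : << mone >> = 1 :> F.
Proof. by []. Qed.

Lemma scale_word (c : C) z : << c *g z >> = c *: << z >> :> F.
Proof. by apply/malgP => k; rewrite mcoeffZ !mcoeffU mulr_natr. Qed.

Lemma malg_sum f : f = \sum_(z <- msupp f) f@_z *: << z >>.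
Proof.
by rewrite {1}[f]monalgE; apply: eq_bigr => z _; rewrite scale_word.
Qed.

Lemma sandwich_def a b f : sandwich a b f = << a >> * f * << b >>.
Proof. by rewrite sandwich.unlock. Qed.

Lemma sandwichD a b f g :
  sandwich a b (f + g) = sandwich a b f + sandwich a b g.
Proof. by rewrite !sandwich_def mulrDr mulrDl. Qed.

Lemma sandwichZ a b (c : C) f : sandwich a b (c *: f) = c *: sandwich a b f.
Proof. by rewrite !sandwich_def free_mulZr free_mulZl. Qed.

Lemma sandwichB a b f g :
  sandwich a b (f - g) = sandwich a b f - sandwich a b g.
Proof. by rewrite -scaleN1r sandwichD sandwichZ scaleN1r. Qed.

Lemma sandwich_sum a b (I : Type) (r : seq I) (P : pred I) (h : I -> F) :
  sandwich a b (\sum_(i <- r | P i) h i) =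
    \sum_(i <- r | P i) sandwich a b (h i).
Proof.
rewrite sandwich_def mulr_sumr mulr_suml.
by apply: eq_bigr => i _; rewrite sandwich_def.
Qed.

Lemma sandwich_word a b u :
  sandwich a b (<< u >> : F) = << mmul (mmul a u) b >>.
Proof. by rewrite !sandwich_def !wordM. Qed.

Lemma sandwichM a b a' b' f :
  sandwich a b (sandwich a' b' f) = sandwich (mmul a a') (mmul b' b) f.
Proof.
rewrite !sandwich_def -(wordM a a') -(wordM b' b).
exact: mulr_assoc5.
Qed.

Lemma sandwich1 f : sandwich mone mone f = f.
Proof. by rewrite !sandwich_def word1 mul1r mulr1. Qed.

Lemma sandwichE a b f :
  sandwich a b f = \sum_(z <- msupp f) f@_z *: << mmul (mmul a z) b >>.
Proof.
rewrite {1}[f]malg_sum sandwich_sum.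
by apply: eq_bigr => z _; rewrite sandwichZ sandwich_word.
Qed.

Lemma mcoeff_sandwich a b f z : (sandwich a b f)@_(mmul (mmul a z) b) = f@_z.
Proof.
rewrite sandwichE raddf_sum [in RHS](malg_sum f) raddf_sum /=.
apply: eq_bigr => y _; rewrite !mcoeffZ !mcoeffU.
congr (_ * (_ *+ nat_of_bool _)).
by apply/eqP/eqP => [/word_mulI|->].
Qed.

Lemma msupp_sandwich a b f y : y \in msupp (sandwich a b f) ->
  exists2 z, z \in msupp f & y = mmul (mmul a z) b.
Proof.
rewrite -mcoeff_neq0 sandwichE raddf_sum /= => nz.
apply: contrapT => nex; case/eqP: nz; rewrite big_seq big1 // => z zf.
rewrite mcoeffZ mcoeffU; case: eqP => [zy|]; last by rewrite mulr0n mulr0.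
by case: nex; exists z.
Qed.

Lemma lead_sandwich a b f : f != 0 ->
  lead le (sandwich a b f) = mmul (mmul a (lead le f)) b.
Proof.
move=> f0; apply: lead_eq.
  by rewrite -mcoeff_neq0 mcoeff_sandwich mcoeff_neq0 lead_supp.
move=> y /msupp_sandwich[z zf ->].
have := lead_max zf; rewrite leq_eqVlt.
case/orP => [/eqP/(word_rank_inj le_linear) ->//|lt].
exact: ltnW (word_rank_mul le_linear a b lt).
Qed.

End Lead.

(** * The composition lemma *)

Lemma scale_cross (K : fieldType) (V : lmodType K) (al be : K) (x y : V) :
  al != 0 -> be != 0 ->
  al^-1 *: x - be^-1 *: y = (al^-1 * be^-1) *: (be *: x - al *: y).
Proof.
move=> al0 be0; rewrite scalerBr !scalerA mulfVK //.
by rewrite [al^-1 * _]mulrC mulfVK.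
Qed.

Lemma scale_merge (K : fieldType) (V : lmodType K) (al be c d : K)
    (x y z : V) : be != 0 ->
  c *: x + (d *: y + z) = (c + d * be * al^-1) *: x +
    ((d * be) *: (be^-1 *: y - al^-1 *: x) + z).
Proof.
move=> be0; rewrite scalerDl scalerBr !scalerA mulfK // -!addrA.
by congr (_ + _); rewrite [RHS]addrCA addNKr.
Qed.

Section CompositionLemma.
Variables (C : numClosedFieldType) (m : nat) (le : rel (gen m)).
Hypothesis le_linear : linear_order le.
Local Notation W := (word m).
Local Notation F := (freeStarAlg C m).
Local Notation rk := (word_rank le).
Implicit Types (u v w a b z : W) (f g h s t : F) (P Q : W -> Prop).

Lemma word_split u v u' v' : mmul u v = mmul u' v' -> (size u <= size u')%N ->
  exists2 c, u' = mmul u c & v = mmul c v'.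
Proof.
move=> e le_uu'; have {e} : u ++ v = u' ++ v' by rewrite -!word_mulE e.
rewrite -{1}(cat_take_drop (size u) u') -catA => /eqP.
rewrite eqseq_cat; last by rewrite size_takel.
case/andP => /eqP eu /eqP ev; exists (FMonom (drop (size u) u')).
  by apply: word_inj; rewrite word_mulE /= {1}eu cat_take_drop.
by apply: word_inj; rewrite word_mulE /= ev.
Qed.

Lemma infix_word u v :
  reflect (exists a b, v = mmul (mmul a u) b) (infix u v).
Proof.
apply: (iffP (@infixP _ u v)) => [[a [b e]]|[a [b ->]]].
  by exists (FMonom a), (FMonom b); apply: word_inj; rewrite !word_mulE e -catA.
by exists a, b; rewrite !word_mulE -catA.
Qed.

Variable S : set F.
Hypothesis S_closed : closed_under_compositions le S.

Let S_neq0 s : S s -> s != 0.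
Proof. by case: S_closed => + _ _; apply. Qed.

(** The elements of the ideal that can be written with multiples [a s b] of
elements of [S] whose leading words all satisfy [P].  Taking for [P] a bound
on the rank gives a filtration of the ideal along which the composition lemma
is proved. *)
Inductive ideal_on P : F -> Prop :=
| IdealOn0 : ideal_on P 0
| IdealOnAdd c a b s f : S s -> P (mmul (mmul a (lead le s)) b) ->
    ideal_on P f -> ideal_on P (c *: sandwich a b s + f).

Lemma ideal_onD P f g : ideal_on P f -> ideal_on P g -> ideal_on P (f + g).
Proof.
move=> If Ig; elim: If => [|c a b s h Ss Ps _ IH]; first by rewrite add0r.
by rewrite -addrA; exact: IdealOnAdd.
Qed.

Lemma ideal_onZ P (c : C) f : ideal_on P f -> ideal_on P (c *: f).
Proof.
elim=> [|d a b s h Ss Ps _ IH]; first by rewrite scaler0; exact: IdealOn0.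
by rewrite scalerDr scalerA; exact: IdealOnAdd.
Qed.

Lemma ideal_onN P f : ideal_on P f -> ideal_on P (- f).
Proof. by rewrite -scaleN1r; exact: ideal_onZ. Qed.

Lemma ideal_onB P f g : ideal_on P f -> ideal_on P g -> ideal_on P (f - g).
Proof. by move=> If /ideal_onN; exact: ideal_onD. Qed.

Lemma ideal_on_sum P (I : eqType) (r : seq I) (h : I -> F) :
  (forall i, i \in r -> ideal_on P (h i)) -> ideal_on P (\sum_(i <- r) h i).
Proof.
elim: r => [|i r IH] Ih; first by rewrite big_nil; exact: IdealOn0.
rewrite big_cons; apply: ideal_onD; first by apply: Ih; rewrite mem_head.
by apply: IH => j jr; apply: Ih; rewrite inE jr orbT.
Qed.

Lemma ideal_on_one P a b s :
  S s -> P (mmul (mmul a (lead le s)) b) -> ideal_on P (sandwich a b s).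
Proof.
move=> Ss Ps; rewrite -[sandwich a b s]addr0 -[sandwich a b s]scale1r.
by apply: IdealOnAdd => //; exact: IdealOn0.
Qed.

Lemma ideal_onW P Q f : (forall w, P w -> Q w) -> ideal_on P f -> ideal_on Q f.
Proof.
move=> PQ; elim=> [|c a b s h Ss Ps _ IH]; first exact: IdealOn0.
by apply: IdealOnAdd => //; exact: PQ.
Qed.

Lemma ideal_on_sandwich P Q a b f :
  (forall w, P w -> Q (mmul (mmul a w) b)) ->
  ideal_on P f -> ideal_on Q (sandwich a b f).
Proof.
move=> PQ; elim=> [|c a' b' s h Ss Ps _ IH].
  by rewrite -(scale0r 0) sandwichZ scale0r; exact: IdealOn0.
rewrite sandwichD sandwichZ sandwichM; apply: IdealOnAdd => //.
by have := PQ _ Ps; rewrite !mulmA.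
Qed.

Lemma ideal_on_mull P b s h : S s ->
  (forall z, z \in msupp h -> P (mmul (mmul z (lead le s)) b)) ->
  ideal_on P (h * s * << b >>).
Proof.
move=> Ss Ph; rewrite {1}[h]malg_sum.
rewrite [(\sum_(z <- msupp h) _) * s]mulr_suml mulr_suml.
apply: ideal_on_sum => z zh; rewrite !free_mulZl; apply: ideal_onZ.
by rewrite -sandwich_def; apply: ideal_on_one => //; exact: Ph.
Qed.

Lemma ideal_on_mulr P a s h : S s ->
  (forall z, z \in msupp h -> P (mmul (mmul a (lead le s)) z)) ->
  ideal_on P (<< a >> * s * h).
Proof.
move=> Ss Ph; rewrite {1}[h]malg_sum mulr_sumr.
apply: ideal_on_sum => z zh; rewrite !free_mulZr; apply: ideal_onZ.
by rewrite -sandwich_def; apply: ideal_on_one => //; exact: Ph.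
Qed.

Lemma ideal_on_supp P f z : ideal_on P f -> z \in msupp f ->
  exists2 w, P w & (rk z <= rk w)%N.
Proof.
elim=> [|c a b s h Ss Ps _ IH]; first by rewrite msupp0.
rewrite -mcoeff_neq0 mcoeffD mcoeffZ.
have [zh|/mcoeff_outdom-> nz] := boolP (z \in msupp h).
  by move=> _; exact: IH.
exists (mmul (mmul a (lead le s)) b) => //.
rewrite -(lead_sandwich le_linear a b (S_neq0 Ss)); apply: lead_max => //.
by rewrite -mcoeff_neq0; apply: contraNneq nz => ->; rewrite mulr0 addr0.
Qed.

Lemma ideal_gen_on f : ideal_gen S f <-> ideal_on (fun=> True) f.
Proof.
split=> [If|].
  apply: (smallest_sub _ _ If).
    split; first exact: IdealOn0.
      by move=> c x y Ix Iy; apply: ideal_onD => //; exact: ideal_onZ.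
    move=> g x Ix; rewrite /smul /=; split.
      rewrite [g]malg_sum mulr_suml; apply: ideal_on_sum => z _.
      rewrite free_mulZl; apply: ideal_onZ.
      have := @ideal_on_sandwich _ (fun=> True) z mone x (fun _ _ => I) Ix.
      by rewrite sandwich_def word1 mulr1.
    rewrite [g]malg_sum mulr_sumr; apply: ideal_on_sum => z _.
    rewrite free_mulZr; apply: ideal_onZ.
    have := @ideal_on_sandwich _ (fun=> True) mone z x (fun _ _ => I) Ix.
    by rewrite sandwich_def word1 mul1r.
  move=> s Ss; rewrite -[s]sandwich1; exact: ideal_on_one.
move=> If J [[J0 Jlin Jmul] SJ]; elim: If => [//|c a b s h Ss _ _ Jh].
apply: Jlin => //; rewrite sandwich_def.
by have [_ +] := Jmul << b >> _ (Jmul << a >> s (SJ _ Ss)).1; apply.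
Qed.

(** Modulo [f], the leading word of [f] equals this combination of smaller
words. *)
Definition lead_tail f : F := << lead le f >> - (lcoeff le f)^-1 *: f.

Lemma lead_tail_lt f z : f != 0 -> z \in msupp (lead_tail f) ->
  (rk z < rk (lead le f))%N.
Proof.
move=> f0; rewrite -mcoeff_neq0 mcoeffB mcoeffZ mcoeffU.
have [<-|nz] := eqVneq (lead le f) z.
  by rewrite mulVf ?subrr ?eqxx // lcoeff_neq0.
rewrite sub0r oppr_eq0 mulf_eq0 negb_or mcoeff_neq0 => /andP[_ zf].
rewrite ltn_neqAle lead_max // andbT.
by apply: contra_neq nz => /(word_rank_inj le_linear).
Qed.

Lemma sandwich_tail a b s :
  << mmul (mmul a (lead le s)) b >> =
    (lcoeff le s)^-1 *: sandwich a b s + sandwich a b (lead_tail s).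
Proof. by rewrite /lead_tail sandwichB sandwich_word sandwichZ addrC subrK. Qed.

Local Notation monic_sandwich a b s := ((lcoeff le s)^-1 *: sandwich a b s).

(** For [x] and [y] the leading words of monic [x'] and [y'], each summand on the
right has a factor [x - x'] or [y - y'], made of smaller words only. *)
Lemma swap_disjoint (K : nzRingType) (a b c x y x' y' : K) :
  a * x' * (c * (y * b)) - a * (x * c) * y' * b =
    a * x' * (c * (y - y') * b) - a * (x - x') * c * y' * b.
Proof.
by rewrite !(mulrBr, mulrBl) !mulrA opprB addrA subrK.
Qed.

Lemma disjoint_resolvable a b c s t : S s -> S t ->
  let w := mmul (mmul a (mmul (lead le s) (mmul c (lead le t)))) b in
  ideal_on (fun v => (rk v < rk w)%N)
    (monic_sandwich a (mmul c (mmul (lead le t) b)) s -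
     monic_sandwich (mmul a (mmul (lead le s) c)) b t).
Proof.
move=> Ss St w; have s0 := S_neq0 Ss; have t0 := S_neq0 St.
have -> : monic_sandwich a (mmul c (mmul (lead le t) b)) s -
    monic_sandwich (mmul a (mmul (lead le s) c)) b t =
    (lcoeff le s)^-1 *: (<< a >> * s * sandwich c b (lead_tail t)) -
    (lcoeff le t)^-1 *: (sandwich a c (lead_tail s) * t * << b >>).
  rewrite -(sandwichZ a _ _ s) -(sandwichZ _ b _ t) /lead_tail.
  set s' := _ *: s; set t' := _ *: t.
  have -> H : (lcoeff le s)^-1 *: (<< a >> * s * H) = << a >> * s' * H.
    by rewrite /s' (free_mulZr _ << a >>) (free_mulZl _ (<< a >> * s)).
  have -> H : (lcoeff le t)^-1 *: (H * t * << b >>) = H * t' * << b >>.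
    by rewrite /t' (free_mulZr _ H) (free_mulZl _ (H * t)).
  rewrite !sandwich_def -!wordM; exact: swap_disjoint.
apply: ideal_onB; apply: ideal_onZ.
  apply: ideal_on_mulr => // z /msupp_sandwich[z' /(lead_tail_lt t0) lt ->].
  have := word_rank_mul le_linear (mmul a (mmul (lead le s) c)) b lt.
  by rewrite /w !mulmA.
apply: ideal_on_mull => // z /msupp_sandwich[z' /(lead_tail_lt s0) lt ->].
have := word_rank_mul le_linear a (mmul c (mmul (lead le t) b)) lt.
by rewrite /w !mulmA.
Qed.

(** The difference is, up to a scalar, the product [a (s, t)_w b], and the
hypothesis on compositions is stable under multiplication by words. *)
Lemma overlap_resolvable a b x y z s t : S s -> S t -> y != mone ->
  lead le s = mmul x y -> lead le t = mmul y z ->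
  let w := mmul (mmul a (mmul (mmul x y) z)) b in
  ideal_on (fun v => (rk v < rk w)%N)
    (monic_sandwich a (mmul z b) s - monic_sandwich (mmul a x) b t).
Proof.
move=> Ss St y1 es et w; have s0 := S_neq0 Ss; have t0 := S_neq0 St.
have [_ _ comp] := S_closed.
have [n [al [a' [b' [r [Sr er]]]]]] := comp s t Ss St x y z y1 es et.
have -> : monic_sandwich a (mmul z b) s - monic_sandwich (mmul a x) b t =
    ((lcoeff le s)^-1 * (lcoeff le t)^-1) *:
      sandwich a b (composition le s t x z).
  have -> : composition le s t x z =
      lcoeff le t *: sandwich mone z s - lcoeff le s *: sandwich x mone t.
    by rewrite !sandwich_def word1 mul1r mulr1.
  rewrite (sandwichB a b (_ *: sandwich mone z s)).
  rewrite (sandwichZ a b (lcoeff le t) (sandwich mone z s)).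
  rewrite (sandwichZ a b (lcoeff le s) (sandwich x mone t)).
  rewrite (sandwichM a b mone z s) (sandwichM a b x mone t) mulm1 mul1m.
  by apply: scale_cross; exact: lcoeff_neq0.
apply: ideal_onZ.
apply: (@ideal_on_sandwich (fun v => (rk v < rk (mmul (mmul x y) z))%N)).
  by move=> v; exact: word_rank_mul.
rewrite er; apply: ideal_on_sum => j _; apply: ideal_onZ.
have [Srj lt] := Sr j; rewrite -sandwich_def in lt *; apply: ideal_on_one => //.
by rewrite -lead_sandwich ?S_neq0 // -word_rankE.
Qed.

(** The two occurrences of leading words in the common word are disjoint, or
they overlap in a nonempty word, or one contains the other.  In the last case
[s = t], [a1 = a2] and [b1 = b2], as no leading word of [S] contains the leading
word of another element. *)
Lemma ambiguity_resolvable a1 b1 a2 b2 s t : S s -> S t ->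
  mmul (mmul a1 (lead le s)) b1 = mmul (mmul a2 (lead le t)) b2 ->
  ideal_on (fun v => (rk v < rk (mmul (mmul a1 (lead le s)) b1))%N)
    (monic_sandwich a1 b1 s - monic_sandwich a2 b2 t).
Proof.
wlog le12 : a1 b1 a2 b2 s t / (size a1 <= size a2)%N.
  move=> H Ss St e; case: (leqP (size a1) (size a2)) => [|/ltnW] le12.
    exact: H.
  by rewrite -opprB; apply: ideal_onN; rewrite e; apply: H.
move=> Ss St e; move: (e); rewrite -!mulmA => e'.
have {e'} [c ea2 e'] := word_split e' le12.
case: (leqP (size (lead le s)) (size c)) => szc.
  have [d ec eb1] := word_split e' szc.
  have := disjoint_resolvable a1 b2 d Ss St.
  by rewrite ea2 ec eb1 !mulmA.
have [y es et] := word_split (esym e') (ltnW szc).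
have y1 : y != mone.
  by apply: contraTneq szc => y1; rewrite es y1 mulm1 ltnn.
case: (leqP (size y) (size (lead le t))) => szy.
  have [z et' eb1] := word_split (esym et) szy.
  have := overlap_resolvable a1 b2 Ss St y1 es et'.
  by rewrite ea2 eb1 es !mulmA.
have [z ey eb2] := word_split et (ltnW szy).
have [_ noinfix _] := S_closed.
have est : t = s.
  apply/eqP/negPn/negP => /(noinfix _ _ St Ss)/negP; apply.
  by apply/infix_word; exists c, z; rewrite es ey mulmA.
have szE := congr1 (fun u : W => size u) es.
have szy' := congr1 (fun u : W => size u) ey.
rewrite /= !word_mulE !size_cat in szE szy'.
move: szE; rewrite szy' est addnCA -{1}[size (lead le s)]addn0.
move=> /addnI/esym/eqP; rewrite addn_eq0 => /andP[c0 z0].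
have c1 : c = mone by apply/eqP; rewrite -fdeg_eq0.
have z1 : z = mone by apply/eqP; rewrite -fdeg_eq0.
rewrite eb2 z1 mul1m ea2 c1 mulm1 subrr; exact: IdealOn0.
Qed.

(** All summands whose leading word has the top rank [n] have the same leading
word; by [ambiguity_resolvable] they can be merged into a single one. *)
Lemma ideal_on_top n f : ideal_on (fun v => (rk v < n.+1)%N) f ->
  ideal_on (fun v => (rk v < n)%N) f \/
  exists c a b s h, [/\ S s, rk (mmul (mmul a (lead le s)) b) = n,
    ideal_on (fun v => (rk v < n)%N) h & f = c *: sandwich a b s + h].
Proof.
elim=> [|c a b s h Ss lt _ IH]; first by left; exact: IdealOn0.
move: lt; rewrite ltnS leq_eqVlt => /orP[/eqP en|lt]; last first.
  case: IH => [Ih|[d [a' [b' [t [h' [St et Ih' ->]]]]]]].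
    by left; exact: IdealOnAdd.
  right; exists d, a', b', t, (c *: sandwich a b s + h').
  split=> [//|//||]; [exact: IdealOnAdd|exact: addrCA].
right; case: IH => [Ih|[d [a' [b' [t [h' [St et Ih' ->]]]]]]].
  by exists c, a, b, s, h.
have ew : mmul (mmul a' (lead le t)) b' = mmul (mmul a (lead le s)) b.
  by apply: (word_rank_inj le_linear); rewrite en et.
have := ambiguity_resolvable St Ss ew; rewrite et => Ih.
set k := d * lcoeff le t; exists (c + k * (lcoeff le s)^-1), a, b, s.
exists (k *: (monic_sandwich a' b' t - monic_sandwich a b s) + h').
split=> [//|//||]; first by apply: ideal_onD => //; exact: ideal_onZ.
by apply: scale_merge; apply: lcoeff_neq0 => //; exact: S_neq0.
Qed.

(** The composition (diamond) lemma.  In a representation whose top part is a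
single summand [c a s b] with [c != 0], nothing cancels the leading word of
[a s b], so it occurs in [f] and is not reduced.  If the top part vanishes, the
bound on the ranks decreases. *)
Theorem composition_lemma f : ideal_gen S f ->
  (forall z, z \in msupp f -> BW le S z) -> f = 0.
Proof.
move=> /ideal_gen_on If.
have {If} [n] : exists n, ideal_on (fun v => (rk v < n)%N) f.
  elim: If => [|c a b s h Ss _ _ [n Ih]]; first by exists 0%N; exact: IdealOn0.
  exists (maxn n (rk (mmul (mmul a (lead le s)) b)).+1).
  apply: IdealOnAdd => //; first by rewrite leq_maxr.
  by apply: ideal_onW Ih => w wn; rewrite leq_max wn.
elim: n f => [|n IH] f.
  by case=> // c a b s h _; rewrite ltn0.
case/ideal_on_top => [|[c [a [b [s [h [Ss en Ih ef]]]]]]]; first exact: IH.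
have [c0|c0] := eqVneq c 0.
  by apply: IH; rewrite ef c0 scale0r add0r.
move=> fBW; suff /fBW/(_ s Ss)/negP[] :
    mmul (mmul a (lead le s)) b \in msupp f.
  by apply/infix_word; exists a, b.
have hw : h@_(mmul (mmul a (lead le s)) b) = 0.
  apply: mcoeff_outdom; apply/negP => /(ideal_on_supp Ih)[w wn].
  by rewrite en leqNgt wn.
rewrite -mcoeff_neq0 ef mcoeffD mcoeffZ mcoeff_sandwich hw addr0.
by rewrite mulf_neq0 // lcoeff_neq0 // S_neq0.
Qed.

End CompositionLemma.

(** * Normal forms *)

Section NormalForm.
Variables (C : numClosedFieldType) (m : nat) (le : rel (gen m)).
Hypothesis le_linear : linear_order le.
Local Notation W := (word m).
Local Notation F := (freeStarAlg C m).
Local Notation rk := (word_rank le).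
Implicit Types (u v w a b z : W) (f g h s t : F).
Variable S : set F.
Hypothesis S_closed : closed_under_compositions le S.
Local Notation I := (ideal_gen S).
Local Notation nf := (normal_form le S).

Definition reduced f : Prop := forall z, z \in msupp f -> BW le S z.

Lemma ideal_gen_ideal : two_sided_ideal I.
Proof.
split=> [J [[]]//|c x y Ix Iy J SJ|a x Ix].
  by have [[_ Jlin _] _] := SJ; apply: Jlin; [exact: Ix|exact: Iy].
by split=> J SJ; have [[_ _ Jmul] _] := SJ; have [] := Jmul a x (Ix _ SJ).
Qed.

Lemma ideal_gen_lin (c : C) f g : I f -> I g -> I (c *: f + g).
Proof. by have [_ + _] := ideal_gen_ideal; apply. Qed.

Lemma ideal_gen0 : I 0.
Proof. by have [] := ideal_gen_ideal. Qed.

Lemma ideal_genB f g : I f -> I g -> I (f - g).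
Proof. by move=> If Ig; rewrite addrC -scaleN1r; exact: ideal_gen_lin. Qed.

Lemma reduced_lin (c : C) f g : reduced f -> reduced g -> reduced (c *: f + g).
Proof.
move=> rf rg z; rewrite -mcoeff_neq0 mcoeffD mcoeffZ.
have [/rg//|/mcoeff_outdom-> nz] := boolP (z \in msupp g).
apply: rf; rewrite -mcoeff_neq0; apply: contraNneq nz => ->.
by rewrite mulr0 addr0.
Qed.

Lemma reduced0 : reduced 0.
Proof. by move=> z; rewrite msupp0. Qed.

Definition is_nf f r := reduced r /\ I (f - r).

Lemma is_nf_lin (c : C) f g r q :
  is_nf f r -> is_nf g q -> is_nf (c *: f + g) (c *: r + q).
Proof.
move=> [rr Ir] [rq Iq]; split; first exact: reduced_lin.
rewrite opprD addrACA -scalerBr; exact: ideal_gen_lin.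
Qed.

Lemma is_nf_ideal f : I f -> is_nf f 0.
Proof. by move=> If; split; [exact: reduced0|rewrite subr0]. Qed.

Lemma is_nf_reduced f : reduced f -> is_nf f f.
Proof. by move=> rf; split => //; rewrite subrr; exact: ideal_gen0. Qed.

Lemma is_nf_unique f r q : is_nf f r -> is_nf f q -> r = q.
Proof.
move=> [rr Ir] [rq Iq]; apply/eqP; rewrite -subr_eq0; apply/eqP.
apply: (composition_lemma le_linear S_closed).
  by rewrite -(subrKA f) -opprB addrC; exact: ideal_genB.
by rewrite -[r - q]addrC -scaleN1r; exact: reduced_lin.
Qed.

Lemma is_nf_sum f : (forall z, z \in msupp f -> exists r, is_nf << z >> r) ->
  exists r, is_nf f r.
Proof.
move=> nfz; have {}nfz : forall z, z \in enum_fset (msupp f) ->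
    exists r, is_nf << z >> r by [].
suff : exists r, is_nf (\sum_(z <- msupp f) f@_z *: << z >>) r.
  by rewrite -malg_sum.
elim: (enum_fset _) nfz => [|z s IH] nfz.
  by rewrite big_nil; exists 0; apply: is_nf_reduced; exact: reduced0.
rewrite big_cons; have [r zr] := nfz z (mem_head _ _).
have [|q sq] := IH; first by move=> y ys; apply: nfz; rewrite inE ys orbT.
by exists (f@_z *: r + q); exact: is_nf_lin.
Qed.

(** By induction on the rank of a word: a word [a (lead s) b] is congruent to
the combination [a (lead_tail s) b] of smaller words. *)
Lemma nf_ex f : exists r, is_nf f r.
Proof.
apply: is_nf_sum => z _; have [n] := ubnP (rk z); elim: n z => // n IH z zn.
have [zBW|] := pselect (BW le S z).
  exists << z >>; apply: is_nf_reduced => y.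
  by rewrite msuppU1 inE => /eqP ->.
move=> /existsNP[s] /not_implyP[Ss] /negP; rewrite negbK.
have s0 : s != 0 by have [+ _ _] := S_closed; apply.
case/infix_word => a [b ez].
have [|r ar] := @is_nf_sum (sandwich a b (lead_tail le s)).
  move=> _ /msupp_sandwich[y ys ->]; apply: IH; move: zn; rewrite ltnS ez.
  apply: leq_trans; apply: word_rank_mul => //.
  exact: (lead_tail_lt le_linear s0).
exists ((lcoeff le s)^-1 *: 0 + r).
rewrite ez sandwich_tail; apply: is_nf_lin ar.
apply: is_nf_ideal; have [_ _ Imul] := ideal_gen_ideal.
rewrite sandwich_def; have Is : I s by move=> J [_ SJ]; exact: SJ.
exact: (Imul << b >> _ (Imul << a >> s Is).1).2.
Qed.

Lemma nfP f : is_nf f (nf f).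
Proof. by rewrite /normal_form; apply: xgetPex; exact: nf_ex. Qed.

Lemma nf_eq f r : is_nf f r -> nf f = r.
Proof. exact: is_nf_unique (nfP f). Qed.

Lemma nf_lin (c : C) f g : nf (c *: f + g) = c *: nf f + nf g.
Proof. by apply: nf_eq; apply: is_nf_lin; exact: nfP. Qed.

Lemma nf_eq0 f : nf f = 0 <-> I f.
Proof.
split=> [f0|/is_nf_ideal/nf_eq//].
by have [_] := nfP f; rewrite f0 subr0.
Qed.

Lemma BW_word a b u : BW le S (mmul (mmul a u) b) -> BW le S u.
Proof.
move=> aub s Ss; apply: contra (aub s Ss) => /infix_word[c [d ->]].
by apply/infix_word; exists (mmul a c), (mmul d b); rewrite !mulmA.
Qed.

End NormalForm.

(** * Hermitian forms with a fast-growing diagonal *)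

(** Course-of-values recursion: iterating [H] from any function stabilizes the
value at [n] after [n.+1] steps. *)
Lemma course_of_values (T : Type) (x0 : T) (H : (nat -> T) -> nat -> T) :
  (forall a b n, (forall k, (k < n)%N -> a k = b k) -> H a n = H b n) ->
  exists a, forall n, a n = H a n.
Proof.
move=> Hloc; pose it N := iter N H (fun=> x0).
have stable n : forall N, (n < N)%N -> it N n = it n.+1 n.
  have [K] := ubnP n; elim: K n => // K IH n nK [//|N] nN /=.
  have kK k : (k < n)%N -> (k < K)%N by lia.
  apply: Hloc => k kn; rewrite -!/(it _).
  by rewrite (IH k (kK k kn) N (leq_trans kn nN)) (IH k (kK k kn) n kn).
exists (fun n => it n.+1 n) => n; rewrite [LHS]/=.
by apply: Hloc => k kn; exact: stable.
Qed.

Section DominatedForm.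
Variables (C : numClosedFieldType) (M : nat -> nat -> C) (c : nat -> C).
Hypothesis M_herm : forall i j, M i j = (M j i)^*.
Hypothesis M_diag : forall j, c j != 0 ->
  M j j = 2 + \sum_(i < j) 2 ^+ j.+1 * (M i j * (M i j)^*).

(** This is [p^-1 * |x + p y|^2]. *)
Lemma cross_term_ge (p x y : C) : 0 < p ->
  0 <= p^-1 * (x * x^*) + p * (y * y^*) + (x * y^* + y * x^*).
Proof.
move=> p0; have pr : p^* = p by apply: conj_Creal; exact: gtr0_real.
have := mul_conjC_ge0 (x + p * y).
rewrite -(pmulr_rge0 _ (x := p^-1)) ?invr_gt0 //.
congr (_ <= _); rewrite rmorphD rmorphM /= pr.
by field; rewrite gt_eqF.
Qed.

(** Adding the index [n] costs at most half of the excess [2^-n] on the part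
already treated: each cross term is absorbed by [2^-(n+1) |c_i|^2] and by
[2^(n+1) |c_n M_in|^2].  The diagonal term [|c_n|^2 M_nn] pays for the latter
and leaves [2 |c_n|^2], at least the required [(1 + 2^-(n+1)) |c_n|^2]. *)
Lemma dominated_form_ge n :
  (1 + 2^-1 ^+ n) * (\sum_(i < n) c i * (c i)^*) <=
  \sum_(i < n) \sum_(j < n) c i * (c j)^* * M i j.
Proof.
elim: n => [|n IH]; first by rewrite !big_ord0 mulr0.
rewrite [X in _ <= X]big_ord_recr /= [X in _ <= _ + X]big_ord_recr /=.
under [X in _ <= X + _]eq_bigr do rewrite big_ord_recr /=.
rewrite big_split [in X in X <= _]big_ord_recr /=.
set s := \sum_(i < n) c i * _ in IH *.
set q := \sum_(i < n) \sum_(j < n) _ in IH *.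
set d := c n * (c n)^*.
have -> : d * M n n =
    d * (2 + \sum_(i < n) 2 ^+ n.+1 * (M i n * (M i n)^*)).
  by rewrite /d; have [->|/M_diag ->//] := eqVneq (c n) 0; rewrite !mul0r.
set p : C := 2 ^+ n.+1; have p0 : 0 < p by rewrite exprn_gt0.
have d0 : 0 <= d by exact: mul_conjC_ge0.
rewrite -subr_ge0.
(* The cross terms with [c n], together with the terms that absorb them. *)
pose r := \sum_(i < n) (p^-1 * (c i * (c i)^*) +
  p * (c n * (M i n)^* * (c n * (M i n)^*)^*) +
  (c i * (c n * (M i n)^*)^* + c n * (M i n)^* * (c i)^*)).
have r0 : 0 <= r by apply: sumr_ge0 => i _; exact: cross_term_ge.
have er : r = p^-1 * s + d * \sum_(i < n) p * (M i n * (M i n)^*) +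
    (\sum_(i < n) c i * (c n)^* * M i n + \sum_(i < n) c n * (c i)^* * M n i).
  rewrite /r /s !mulr_sumr -!big_split /=; apply: eq_bigr => i _.
  rewrite [M n i]M_herm /d !rmorphM /= !conjCK; ring.
have ep : 2^-1 ^+ n = p^-1 + p^-1 :> C.
  by rewrite /p exprS exprVn; field; rewrite expf_neq0 // pnatr_eq0.
have ep' : 2^-1 ^+ n.+1 = p^-1 :> C by rewrite exprVn.
have p1 : 0 <= d * (1 - p^-1).
  by rewrite mulr_ge0 // subr_ge0 invf_le1 // /p exprn_ege1 // ler1n.
rewrite -subr_ge0 ep in IH.
apply: le_trans (addr_ge0 (addr_ge0 IH r0) p1) _.
rewrite le_eqVlt; apply/orP; left; apply/eqP.
by rewrite er ep'; ring.
Qed.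

Lemma dominated_form_gt0 n : (exists2 i, (i < n)%N & c i != 0) ->
  0 < \sum_(i < n) \sum_(j < n) c i * (c j)^* * M i j.
Proof.
move=> [k kn ck]; apply: lt_le_trans (dominated_form_ge n).
rewrite mulr_gt0 ?addr_gt0 ?exprn_gt0 ?invr_gt0 ?ltr0n //.
rewrite (bigD1 (Ordinal kn)) //= ltr_wpDr ?mul_conjC_gt0 //.
by apply: sumr_ge0 => i _; exact: mul_conjC_ge0.
Qed.

End DominatedForm.

(** * A faithful positive functional *)

Section ConjAverage.
Variable C : numClosedFieldType.
Implicit Types c x y : C.

Lemma conj_average_lin c x y x' y' :
  2^-1 * (c * x + y + (c^* * x' + y')^*) =
    c * (2^-1 * (x + x'^*)) + 2^-1 * (y + y'^*).
Proof. by rewrite rmorphD rmorphM /= conjCK; ring. Qed.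

Lemma conj_average x y : 2^-1 * (x + y^*) = (2^-1 * (y + x^*))^*.
Proof.
by rewrite rmorphM rmorphD /= conjCK fmorphV rmorph_nat addrC.
Qed.

End ConjAverage.

Section PositiveFunctional.
Variables (C : numClosedFieldType) (m : nat) (le : rel (gen m)).
Hypothesis le_linear : linear_order le.
Local Notation W := (word m).
Local Notation F := (freeStarAlg C m).
Local Notation rk := (word_rank le).
Implicit Types (u v w z : W) (f g h : F).
Variable S : set F.
Hypothesis S_strict : strictly_non_expanding le S.
Local Notation I := (ideal_gen S).
Local Notation nf := (normal_form le S).

Let S_closed : closed_under_compositions le S.
Proof. by case: S_strict => -[]. Qed.

Let S_sym f : I f -> I (star f).
Proof.
case: S_strict => -[sym _ _] _ If.
by rewrite -sym; exists f.
Qed.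

Let nf_ok f : is_nf le S f (nf f).
Proof. exact: (nfP le_linear S_closed). Qed.

Definition first_half z : W := FMonom (take (size z)./2 z).

Lemma size_word_star u : size (word_star u) = size u.
Proof. by rewrite /= size_rev size_map. Qed.

Lemma first_half_square u : first_half (mmul u (word_star u)) = u.
Proof.
apply: word_inj; rewrite /= word_mulE size_cat size_word_star addnn doubleK.
by rewrite take_size_cat.
Qed.

(** A word is of the form [w w^*] for at most one [w], its first half. *)
Definition square_weight (a : nat -> C) z : C :=
  let w := first_half z in if z == mmul w (word_star w) then a (rk w) else 0.

Definition square_fun (a : nat -> C) f : C :=
  mmap idfun (square_weight a) (nf f).

Lemma square_fun_lin a (c : C) f g :
  square_fun a (c *: f + g) = c * square_fun a f + square_fun a g.
Proof.
rewrite /square_fun (nf_lin le_linear S_closed) mmapD; congr (_ + _).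
rewrite (mmapEw (msuppZ_le _ _)) mmapE mulr_sumr.
by apply: eq_bigr => z _; rewrite mcoeffZ /= mulrA.
Qed.

Lemma square_fun_ideal a f : I f -> square_fun a f = 0.
Proof.
by move=> /(nf_eq0 le_linear S_closed) f0; rewrite /square_fun f0 mmap0.
Qed.

Lemma square_fun_square a u :
  BW le S u -> square_fun a << mmul u (word_star u) >> = a (rk u).
Proof.
move=> uBW; case: S_strict => _ /(_ u uBW) uuBW.
have -> : square_fun a << mmul u (word_star u) >> =
    square_weight a (mmul u (word_star u)).
  rewrite /square_fun.
  rewrite (nf_eq le_linear S_closed (r := << mmul u (word_star u) >>)).
    by rewrite mmapU mul1r.
  by apply: is_nf_reduced => z; rewrite msuppU1 inE => /eqP ->.
by rewrite /square_weight first_half_square eqxx.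
Qed.

(** The weights that enter are those of the words [w] with [w w^*] in the normal
form of [u v^*]; the non-expanding condition bounds them by [u] or [v]. *)
Lemma square_fun_local a b n u v : BW le S u -> BW le S v -> u != v ->
  (rk u <= n)%N -> (rk v <= n)%N ->
  (forall k, (k < n)%N -> a k = b k) ->
  square_fun a << mmul u (word_star v) >> =
    square_fun b << mmul u (word_star v) >>.
Proof.
move=> uBW vBW uv un vn ab.
rewrite /square_fun !mmapE big_seq [RHS]big_seq.
apply: eq_bigr => z zn; congr (_ * _); rewrite /square_weight.
case: eqP => [ez|//]; apply: ab.
have wBW : BW le S (first_half z).
  have [red _] := nf_ok << mmul u (word_star v) >>.
  apply: (@BW_word _ _ _ _ mone (word_star (first_half z))).
  by rewrite mul1m -ez; exact: red.
case: S_strict => -[_ _ ne] _; rewrite ez in zn.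
by case: (ne u v (first_half z) uBW vBW wBW uv zn);
  rewrite word_rankE // => lt; apply: leq_trans lt _.
Qed.

(** The set of reduced words need not be stable under the involution, so
[square_fun a] alone need not be Hermitian. *)
Definition herm_fun (a : nat -> C) f : C :=
  2^-1 * (square_fun a f + (square_fun a (star f))^*).

Lemma herm_fun_lin a (c : C) f g :
  herm_fun a (c *: f + g) = c * herm_fun a f + herm_fun a g.
Proof.
rewrite /herm_fun starD starZ !square_fun_lin; exact: conj_average_lin.
Qed.

Lemma herm_fun_star a f : herm_fun a (star f) = (herm_fun a f)^*.
Proof.
rewrite /herm_fun starK; exact: conj_average.
Qed.

Lemma herm_fun_ideal a f : I f -> herm_fun a f = 0.
Proof.
move=> If; rewrite /herm_fun (square_fun_ideal a If).
by rewrite (square_fun_ideal a (S_sym If)) rmorph0 addr0 mulr0.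
Qed.

Lemma herm_fun_square_mod a f g : I (f - g) ->
  herm_fun a (smul f (star f)) = herm_fun a (smul g (star g)).
Proof.
move=> Ifg; have [_ _ Imul] := ideal_gen_ideal S.
apply: (star_square_mod (herm_fun_lin a)); apply: herm_fun_ideal.
  exact: (Imul (star f) (f - g) Ifg).2.
exact: (Imul g _ (S_sym Ifg)).1.
Qed.

Definition word_of_rank n : W := xget mone [set w | rk w = n]%classic.

Lemma word_of_rankK u : word_of_rank (rk u) = u.
Proof.
apply: (word_rank_inj le_linear).
rewrite /word_of_rank.
by apply: (@xgetPex _ mone [set w | rk w = rk u]%classic); exists u.
Qed.

Definition basis_rank n : bool :=
  (rk (word_of_rank n) == n) && `[< BW le S (word_of_rank n) >].

Lemma basis_rankP n : basis_rank n ->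
  rk (word_of_rank n) = n /\ BW le S (word_of_rank n).
Proof. by case/andP => /eqP e /asboolP. Qed.

Lemma basis_rank_word u : BW le S u -> basis_rank (rk u).
Proof. by move=> uBW; rewrite /basis_rank word_of_rankK eqxx; apply/asboolP. Qed.

(** The matrix [tau (u v^* )] over the reduced words, indexed by their ranks and
extended by [0] to the ranks of the other words. *)
Definition gram (a : nat -> C) i j : C :=
  if basis_rank i && basis_rank j then
    herm_fun a << mmul (word_of_rank i) (word_star (word_of_rank j)) >>
  else 0.

Lemma star_word u v :
  star (<< mmul u (word_star v) >> : F) = << mmul v (word_star u) >>.
Proof.
by rewrite /star /= free_starU rmorph1 word_starM word_starK.
Qed.

Lemma gram_herm a i j : gram a i j = (gram a j i)^*.
Proof.
rewrite /gram andbC; case: (basis_rank j && basis_rank i).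
  rewrite -[in LHS](star_word (word_of_rank j) (word_of_rank i)).
  exact: herm_fun_star.
by rewrite rmorph0.
Qed.

Lemma gram_local a b i n : (i < n)%N -> (forall k, (k < n)%N -> a k = b k) ->
  gram a i n = gram b i n.
Proof.
move=> i_n ab; rewrite /gram; case: ifP => // /andP[].
move=> /basis_rankP[ei iBW] /basis_rankP[en nBW].
have ne : word_of_rank i != word_of_rank n.
  by apply: contraTneq i_n => e; rewrite -ei -en e ltnn.
rewrite /herm_fun (star_word (word_of_rank i) (word_of_rank n)).
have lei : (rk (word_of_rank i) <= n)%N by rewrite ei ltnW.
have len : (rk (word_of_rank n) <= n)%N by rewrite en.
rewrite (square_fun_local iBW nBW ne lei len ab).
by rewrite eq_sym in ne; rewrite (square_fun_local nBW iBW ne len lei ab).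
Qed.

Lemma gram_diag a j : (a j)^* = a j -> basis_rank j -> gram a j j = a j.
Proof.
move=> aj jB; rewrite /gram jB /=; have [ej jBW] := basis_rankP jB.
rewrite /herm_fun (star_word (word_of_rank j)) square_fun_square // ej aj.
by field.
Qed.

(** By [gram_local] the right-hand side only involves the values of [a] below
[n], so the equation is a recursive definition. *)
Lemma growing_weights : exists a : nat -> C, forall n,
  a n = 2 + \sum_(i < n) 2 ^+ n.+1 * (gram a i n * (gram a i n)^*).
Proof.
apply: (course_of_values 0) => a b n ab; congr (_ + _).
by apply: eq_bigr => i _; rewrite (gram_local (b := b)).
Qed.

(** Modulo the ideal, [f] is its normal form [g != 0], and [tau (g g^* )] is the
value of the form with matrix [gram a] at the coefficients of [g]. *)
Lemma herm_fun_pos a : (forall n,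
    a n = 2 + \sum_(i < n) 2 ^+ n.+1 * (gram a i n * (gram a i n)^*)) ->
  forall f, ~ I f -> 0 < herm_fun a (smul f (star f)).
Proof.
move=> aE f If; have a_real n : (a n)^* = a n.
  apply: conj_Creal; apply: ger0_real; rewrite aE addr_ge0 ?ler0n //.
  by apply: sumr_ge0 => i _; rewrite mulr_ge0 ?exprn_ge0 ?mul_conjC_ge0.
set g := nf f; have [red Ifg] := nf_ok f; rewrite -/g in red Ifg.
have g0 : g != 0 by apply/eqP => /(nf_eq0 le_linear S_closed).
rewrite (herm_fun_square_mod a Ifg).
move: g red g0 {Ifg} => g red g0.
pose c i : C := if basis_rank i then g@_(word_of_rank i) else 0.
pose n := (rk (lead le g)).+1.
have rkn z : z \in msupp g -> (rk z < n)%N by move=> zg; exact: lead_max.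
have eg : g = \sum_(i < n) c i *: << word_of_rank i >>.
  apply/malgP => z; rewrite raddf_sum /=.
  have [zg|zg] := boolP (z \in msupp g).
    rewrite (bigD1 (Ordinal (rkn z zg))) //= big1 ?addr0.
      rewrite mcoeffZ word_of_rankK mcoeffUU mulr1 /c word_of_rankK.
      by rewrite basis_rank_word //; exact: red.
    move=> i; rewrite -val_eqE /= => iz; rewrite mcoeffZ /c.
    case: ifP => [/basis_rankP[ei _]|_]; last by rewrite mul0r.
    rewrite mcoeffU1; case: eqP => [e|_]; last by rewrite mulr0.
    by rewrite -e ei eqxx in iz.
  rewrite (mcoeff_outdom zg) big1 // => i _; rewrite mcoeffZ /c.
  case: ifP => _; last by rewrite mul0r.
  rewrite mcoeffU1; case: eqP => [->|_]; last by rewrite mulr0.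
  by rewrite (mcoeff_outdom zg) mul0r.
have -> : herm_fun a (smul g (star g)) =
    \sum_(i < n) \sum_(j < n) c i * (c j)^* * gram a i j.
  rewrite eg.
  apply: etrans (star_square_sum (herm_fun_lin a) n c
    (fun i => << word_of_rank i >>)) _.
  apply: eq_bigr => i _; apply: eq_bigr => j _; rewrite /gram /c.
  case: (basis_rank i); last by rewrite !mul0r.
  case: (basis_rank j); last by rewrite rmorph0 mulr0 !mul0r.
  congr (_ * herm_fun a _).
  by rewrite /smul /= /star /= free_starU rmorph1 wordM.
apply: dominated_form_gt0.
- exact: gram_herm.
- move=> j; rewrite {1}/c; case: ifP => [jB _|_]; last by rewrite eqxx.
  by rewrite gram_diag.
exists (rk (lead le g)); first by apply: rkn; exact: lead_supp.
rewrite /c word_of_rankK basis_rank_word; last by apply: red; exact: lead_supp.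
by rewrite mcoeff_neq0 lead_supp.
Qed.

End PositiveFunctional.

Theorem corollary7 (R : realType) (A : starAlgType R[i]) :
  strictly_non_expanding_algebra A -> O_star_representable A.
Proof.
move=> [m [le [S [I [le_linear S_strict IE iso]]]]].
have [a aE] := growing_weights le_linear S_strict.
apply: (quotient_representable _ _ _ _ iso (tau := herm_fun le S a)).
- exact: herm_fun_lin.
- exact: herm_fun_star.
- by move=> f /IE; exact: herm_fun_ideal.
- by move=> f /negP fI; apply: herm_fun_pos => // If; apply: fI; exact/IE.
Qed.
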